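(* Let $p$ be a prime and let $q$ be an odd prime that divides $p-1$. Then there exists a finite solvable group $G$ with $\mathrm{dl}(G)=4$, Fitting height $3$, and $$\mathrm{cd}(G)=\{1,\ q,\ (p^q-1)_{q'}(p-1)_q\,q,\ p^q q\}.$$
   Context: $\mathrm{cd}(G)$ is the set of degrees of irreducible complex characters of $G$, and $\mathrm{dl}(G)$ is the derived length of $G$. For a positive integer $N$ and a prime $q$, $N_q$ denotes the largest power of $q$ dividing $N$, and $N_{q'}=N/N_q$. *)

(* Defs.v *)
From HB Require Import structures.
From mathcomp Require Import all_boot all_order all_algebra all_fingroup all_solvable all_field all_character.
Set Implicit Arguments. Unset Strict Implicit. Unset Printing Implicit Defensive.
Import GRing.Theory Num.Theory.
Local Open Scope group_scope.

Fixpoint Fitting_series (gT : finGroupType) (G : {group gT}) (n : nat)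
  : {group gT} :=
  match n with
  | 0 => 1%G
  | n'.+1 => let H := Fitting_series G n' in
             (coset H @*^-1 'F(G / H))%G
  end.

Definition Fitting_height_is (gT : finGroupType) (G : {group gT}) (n : nat) :=
  (Fitting_series G n :==: G) /\ (forall m, (m < n)%N -> Fitting_series G m :!=: G).

Definition derived_length_is (gT : finGroupType) (G : {group gT}) (n : nat) :=
  (G^`(n) :==: 1) /\ (forall m, (m < n)%N -> G^`(m) :!=: 1).

Definition in_cd (gT : finGroupType) (G : {group gT}) (d : algC) :=
  exists i : Iirr G, ('chi[G]_i 1%g)%R = d.

(* Main.v *)
(* By lifting the exponent at q, the third degree is p^q - 1. Let F be the field
   with p^q elements. As q divides p - 1, there is a Dickson nearfield on F: a
   group H of order p^q - 1 of semilinear maps x |-> c * x^(p^i(c)), regular on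
   the nonzero elements of F, where c^N = zeta^i(c) for N = (p^q - 1) / q and a
   primitive q-th root of unity zeta. Let P = F x F x F_p be the Heisenberg group
   with cocycle Tr(x y'), on which c acts by
     (x, y, z) |-> (c x^(p^i), c^(N-1) y^(p^i), c^N z),
   let Z be the centre of P, let G = P H and M = C_G(Z); then M has index q.
   The quotient G/Z is a Frobenius group with kernel P/Z, which yields the degree
   |H|; G/P is nonabelian with the abelian subgroup M/P of index q, which yields
   1 and q; and a character of P nontrivial on Z is fully ramified over Z with
   inertia group M, hence extends to M and induces to degree q p^q. The Fitting
   series is 1 < P < M < G, and G^(3) is nontrivial because P lies in G^(2) Z. *)

Require Import Defs.
From HB Require Import structures.
From mathcomp Require Import all_boot all_order all_algebra all_fingroup all_solvable all_field all_character.
From mathcomp Require Import ring.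
Import GRing.Theory Num.Theory.

Set Implicit Arguments.
Unset Strict Implicit.
Unset Printing Implicit Defensive.

(** * Character degrees, derived length and Fitting height *)

Section CharacterDegrees.

Local Open Scope group_scope.
Local Open Scope ring_scope.

(** By Clifford theory in prime index, the restriction to [M] is irreducible or a sum of |G : M|
    irreducible characters, and those of the abelian [M] are linear. *)
Lemma irr1_abelian_prime_index (gT : finGroupType) (G M : {group gT}) i :
    M <| G -> prime #|G : M| -> abelian M ->
  ('chi[G]_i 1%g = 1 \/ 'chi[G]_i 1%g = #|G : M|%:R)%R.
Proof.
move=> nsMG pr_iGM abM.
have lin1 (j : Iirr M) : ('chi_j 1%g = 1)%R.
  by apply/lin_char1/char_abelianP; rewrite ?irr_char.
have [/irrP[j Dj] | [c _ Dc]] := cfRes_prime_irr_cases i nsMG (erefl _) pr_iGM.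
  by left; rewrite -(cfRes1 M) Dj lin1.
right; rewrite -(cfRes1 M) Dc sum_cfunE (eq_bigr (fun=> 1%R)) => [|k _] //.
by rewrite sumr_const card_ord.
Qed.

(** Coprimeness extends ['chi_i] to its inertia group [M]. By Gallagher, the characters of [M] above
    it are the products of this extension with characters of the abelian group [M / P], which are
    linear. The Clifford correspondence then induces them irreducibly to [G]. *)
Lemma irr1_coprime_abelian_inertia (gT : finGroupType) (G M P : {group gT})
    (i : Iirr P) (j : Iirr G) :
    P <| G -> M \subset G -> 'I_G['chi_i] = M -> abelian (M / P) ->
    coprime #|M : P| #|P| ->
    i \in irr_constt ('Res[P] 'chi_j) ->
  ('chi_j 1%g = #|G : M|%:R * 'chi_i 1%g)%R.
Proof.
move=> nsPG sMG IGi abMP coMP; rewrite -constt_Ind_Res => sGj.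
have sPM : P \subset M by rewrite -IGi sub_Inertia ?normal_sub.
have nsPM : P <| M := normalS sPM sMG nsPG.
(* The extension theorem wants |M : P| coprime to the degree and to the determinantal order of
   ['chi_i]; both divide |P|. *)
have dv_i : (Num.truncn ('chi_i 1%g)%R %| #|P|)%N.
  have := dvd_irr1_cardG i; have /natrP[n ->] := Cnat_irr1 i.
  by rewrite dvdC_nat natrK.
have [c [Dc _ _]] : exists c, [/\ 'Res 'chi[M]_c = 'chi_i,
    'o('chi_c)%CF = 'o('chi_i)%CF & forall d, 'Res 'chi_d = 'chi_i ->
     coprime #|M : P| 'o('chi_d)%CF -> d = c].
  apply: extend_solvable_coprime_irr => //; first exact: abelian_sol.
    by rewrite -{1}IGi subsetIr.
  by rewrite coprimeMr (coprime_dvdr (cfDet_order_dvdG _)) ?(coprime_dvdr dv_i).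
have [irrM _ im _] := constt_Ind_ext nsPM Dc.
have [irrI _ Bij _ _] := constt_Inertia_bijection i nsPG.
have defT : 'I_G['chi_i]%G = M by apply: group_inj.
rewrite defT in irrI Bij; move: sGj; rewrite -Bij => /imsetP[s Is ->].
have irr_s := irrI s Is; move: Is; rewrite im => /codomP[b Ds].
rewrite cfIirrE // cfInd1 //; congr (_ * _)%R.
rewrite Ds cfIirrE ?irrM // cfunE mod_IirrE // cfMod1.
rewrite (lin_char1 (_ : 'chi_b \is a linear_char)) ?mul1r -?Dc ?cfRes1 //.
by apply/char_abelianP; rewrite ?irr_char.
Qed.

(** Two elements with the same commutator with [g] differ by a fixed point of [g], so x |-> [x, g]
    is injective on the finite group [Q], hence onto. *)
Lemma comm_set_fixed_point_free (gT : finGroupType) (Q : {group gT}) g :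
    g \in 'N(Q) -> 'C_Q[g] = 1%g -> [set [~ x, g] | x in Q] = Q :> {set gT}.
Proof.
move=> nQg fpf; apply/eqP; rewrite eqEcard; apply/andP; split.
  apply/subsetP=> _ /imsetP[x Qx ->].
  by rewrite commgEl groupM ?groupV ?memJ_norm.
rewrite card_in_imset // => x y Qx Qy; rewrite !commgEl => eqxy.
have eqyx : ((y * x^-1) ^ g = y * x^-1)%g.
  by apply: (mulIg (x ^ g)%g); rewrite conjMg conjVg mulgKV -mulgA eqxy mulKVg.
have : (y * x^-1)%g \in 'C_Q[g].
  by rewrite inE groupM ?groupV //; apply/cent1P/commgP/conjg_fixP.
by rewrite fpf => /set1P/(canRL (mulgKV _)); rewrite mul1g.
Qed.

(** * Degrees, derived length and Fitting height from the abstract structure 1 < Z < P < M < G *)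

Section FrobeniusOverHeisenberg.

Variables (gT : finGroupType) (G M P Z : {group gT}).
Hypotheses (nsZG : Z <| G) (nsPG : P <| G) (nsMG : M <| G).
Hypotheses (sZP : Z \subset P) (sPM : P \subset M).
Hypotheses (ntZ : Z :!=: 1%g) (prPZ : P :!=: Z).
Hypothesis der1P : P^`(1)%g \subset Z.
Hypothesis comm_P :
  {in P :\: Z & Z, forall x z, exists2 y, y \in P & z = [~ x, y]}.
Hypothesis cZM : M \subset 'C(Z).
Hypothesis comm_G :
  {in G :\: M & Z, forall g z, exists2 y, y \in Z & z = [~ y, g]}.
(** The Frobenius condition for G/Z, stated without quotients: elements outside [P] act on P/Z
    without nontrivial fixed points. *)
Hypothesis regGP : {in P & G :\: P, forall x g, [~ x, g] \in Z -> x \in Z}.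
Hypotheses (prGM : prime #|G : M|) (abMP : abelian (M / P)).
Hypothesis coMP : coprime #|M : P| #|P|.
Hypothesis nilP : nilpotent P.
Hypothesis nnilGP : ~~ nilpotent (G / P).

Let sPG : P \subset G := normal_sub nsPG.
Let sMG : M \subset G := normal_sub nsMG.
Let nsZP : Z <| P := normalS sZP sPG nsZG.
Let nsPM : P <| M := normalS sPM sMG nsPG.

(** For x in the centre of the character, [x, P] lies in its kernel; if x were outside [Z], then by
    [comm_P] these commutators would cover [Z]. *)
Lemma cfcenter_faithful_on_center (i : Iirr P) :
  ~~ (Z \subset cfker 'chi_i) -> 'Z('chi_i)%CF = Z.
Proof.
move=> nkZ; have cPZ : P \subset 'C(Z) := subset_trans sPM cZM.
have sZZP : Z \subset 'Z(P) by rewrite subsetI sZP centsC.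
apply/eqP; rewrite eqEsubset andbC -cap_cfcenter_irr in sZZP *.
rewrite (subset_trans sZZP) ?bigcap_inf //=.
apply: contraR nkZ => /subsetPn[x Zx nZx]; apply/subsetP=> z Zz.
have Px : x \in P := subsetP (cfcenter_sub _) x Zx.
have [|y Py ->] := comm_P _ Zz (x := x); first by rewrite inE nZx.
have nKP : P \subset 'N(cfker 'chi_i) := normal_norm (cfker_normal _).
have := cfcenter_subset_center 'chi_i.
rewrite subsetI => /andP[_].
have nKZ : 'Z('chi_i)%CF \subset 'N(cfker 'chi_i).
  exact: subset_trans (cfcenter_sub _) nKP.
rewrite quotient_cents2 // => /subsetP-> //.
by rewrite mem_commg.
Qed.

Lemma irr1_faithful_on_center (i : Iirr P) :
  ~~ (Z \subset cfker 'chi_i) -> 'chi_i 1%g ^+ 2 = #|P : Z|%:R.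
Proof.
move=> nkZ; rewrite -(cfcenter_faithful_on_center nkZ) irr1_abelian_bound //.
rewrite (cfcenter_faithful_on_center nkZ) sub_der1_abelian //.
Qed.

(** The character attains the bound on its degree, so it vanishes off [Z], and [M] centralises [Z];
    hence [M] fixes it. Conversely, an element g outside [M] that fixed it would fix the linear
    character below it on [Z], whose kernel would then contain all [y, g], that is, all of [Z] by
    [comm_G]. *)
Lemma inertia_faithful_on_center (i : Iirr P) :
  ~~ (Z \subset cfker 'chi_i) -> 'I_G['chi_i] = M.
Proof.
move=> nkZ; have defZ := cfcenter_faithful_on_center nkZ.
have /cfun_onP chi0 : 'chi_i \in 'CF(P, Z).
  rewrite -{1}defZ -(irr1_bound i).2 defZ.
  by rewrite (irr1_faithful_on_center nkZ).
apply/eqP; rewrite eqEsubset; apply/andP; split; last first.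
  apply/subsetP=> g Mg; have Gg := subsetP sMG g Mg.
  have nPg := subsetP (normal_norm nsPG) g Gg.
  have nZg := subsetP (normal_norm nsZG) g Gg.
  rewrite inE Gg inE nPg; apply/eqP/cfun_inP=> x Px; rewrite cfConjgE //.
  have [Zx | nZx] := boolP (x \in Z).
    by rewrite /conjg invgK mulgA (centsP cZM g Mg x Zx) mulgK.
  by rewrite !chi0 // memJ_norm ?groupV.
apply/subsetP=> g /setIP[Gg Ig]; apply: contraR nkZ => nMg.
have [chi1 lin1 /cfunP resZ] := cfcenter_Res 'chi_i.
apply/subsetP=> z Zz.
have [|y Zy Dz] := comm_G _ Zz (x := g); first by rewrite inE nMg.
have resE x : x \in Z -> 'chi_i x = 'chi_i 1%g * chi1 x.
  by move=> Zx; have := resZ x; rewrite cfResE ?cfcenter_sub ?defZ // cfunE.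
have nZg := subsetP (normal_norm nsZG) g Gg.
have Zyg : (y ^ g)%g \in Z by rewrite memJ_norm.
have: 'chi_i (y ^ g)%g = 'chi_i y by apply: inertia_valJ.
rewrite (resE _ Zyg) (resE _ Zy) => /(mulfI (irr1_neq0 i)) eqyg.
have centZ x : x \in Z -> x \in cfcenter_group 'chi_i by rewrite /= defZ.
rewrite cfkerEirr inE (resE _ Zz) Dz commgEl lin_charM ?groupV ?centZ //.
by rewrite eqyg lin_charV ?mulVf ?lin_char_neq0 ?mulr1 ?centZ.
Qed.

Lemma Frobenius_quotient_kernel : [Frobenius G / Z with kernel P / Z].
Proof.
have nZG := normal_norm nsZG; have nZP := normal_norm nsZP.
apply/Frobenius_kerP; split.
- by rewrite -subG1 quotient_sub1 //; apply: contra prPZ => sPZ; rewrite eqEsubset sPZ.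
- rewrite properEneq quotientS // andbT; apply: contra nnilGP => /eqP eqPG.
  suffices /eqP-> : (G / P)%g == 1%g by apply: nilpotent1.
  by rewrite -subG1 quotient_sub1 ?normal_norm // -(quotientSGK nZG sZP) eqPG.
- exact: quotient_normal.
move=> xb /setD1P[ntx /morphimP[x Nx Px /= Dx]].
rewrite {xb}Dx in ntx *.
apply/subsetP=> _ /setIP[/morphimP[g Ng Gg /= ->] /cent1P cxg].
apply: mem_quotient; apply: contraR ntx => nPg.
rewrite coset_id //; apply: (regGP Px (y := g)); first by rewrite inE nPg.
by apply: coset_idr; rewrite ?groupR // morphR //; apply/eqP/commgP.
Qed.

(** Irreducible characters are sorted by whether their kernel contains [P], only [Z], or not even
    [Z]; these cases yield the degrees 1 and |G : M|, then |G : P|, then |G : M| n. *)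
Lemma irr1_FrobeniusOverHeisenberg n : #|P : Z| = (n ^ 2)%N ->
  forall d : algC, in_cd G d <->
    d = 1 \/ d = #|G : M|%:R \/ d = #|G : P|%:R \/ d = (#|G : M| * n)%:R.
Proof.
move=> iPZ; have frobGZ := Frobenius_quotient_kernel.
have irr1_faithful (j : Iirr G) : ~~ (Z \subset cfker 'chi_j) ->
    'chi_j 1%g = (#|G : M| * n)%:R.
  move=> nkZ; have [i Rji] := constt_cfRes_irr P j.
  have nkiZ : ~~ (Z \subset cfker 'chi_i).
    (* As [Z] is normal in [G], a kernel containing it below still contains it after induction,
       hence in the constituent ['chi_j]. *)
    apply: contra nkZ => kZ.
    have kInd : Z \subset cfker ('Ind[G] 'chi_i).
      by rewrite cfker_Ind_irr // sub_gcore ?normal_norm.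
    apply: subset_trans kInd (cfker_constt _ _); rewrite ?cfInd_char ?irr_char //.
    by rewrite constt_Ind_Res.
  have IGi := inertia_faithful_on_center nkiZ.
  rewrite (irr1_coprime_abelian_inertia nsPG sMG IGi abMP coMP Rji) natrM.
  congr (_ * _); apply/eqP; rewrite -(@eqrXn2 _ 2) ?ler0n ?char1_ge0 ?irr_char //.
  by rewrite irr1_faithful_on_center // iPZ natrX.
have iGPM : #|G / P : M / P| = #|G : M|.
  by rewrite index_quotient_eq ?normal_norm // (subset_trans _ sPM) ?subsetIr.
have nsMPG : M / P <| G / P := quotient_normal _ nsMG.
have irr1_GP (j : Iirr (G / P)) :
    'chi_j 1%g = 1 \/ 'chi_j 1%g = #|G : M|%:R.
  by rewrite -iGPM; apply: irr1_abelian_prime_index; rewrite ?iGPM.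
have iGZP : #|G / Z : P / Z| = #|G : P|.
  by rewrite index_quotient_eq ?normal_norm // (subset_trans _ sZP) ?subsetIr.
move=> d; split=> [[j <-{d}] | [->|[->|[->|->]]]].
- have [kP | nkP] := boolP (P \subset cfker 'chi_j).
    rewrite -(quo_IirrK nsPG kP) mod_IirrE // cfMod1.
    by have [->|->] := irr1_GP (quo_Iirr P j); auto.
  have [kZ | /irr1_faithful] := boolP (Z \subset cfker 'chi_j); last by auto.
  rewrite -(quo_IirrK nsZG kZ) mod_IirrE // cfMod1.
  have [|i _ ->] := Frobenius_Ind_irrP frobGZ (quo_Iirr Z j) _.
    by rewrite quo_IirrE // cfker_quo // quotientSGK ?normal_norm.
  rewrite cfInd1 ?quotientS // iGZP lin_char1 ?mulr1; first by auto.
  by apply/char_abelianP; rewrite ?irr_char // sub_der1_abelian.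
- by exists 0; rewrite irr0 cfun11.
(* [G / P] is not nilpotent, so not abelian, and has a nonlinear irreducible character. *)
- have /existsP[j] : [exists j : Iirr (G / P), 'chi_j \isn't a linear_char].
    apply: contraR nnilGP => /existsPn linGP; apply: abelian_nil.
    by apply/char_abelianP => i; have := linGP i; rewrite negbK.
  rewrite qualifE/= irr_char => nlin; exists (mod_Iirr j).
  rewrite mod_IirrE // cfMod1; case: (irr1_GP j) => // e.
  by rewrite e eqxx in nlin.
- have [/has_nonprincipal_irr[i nzi] _ _ _] := Frobenius_kerP frobGZ.
  have /irrP[j Dj] := irr_induced_Frobenius_ker frobGZ nzi.
  exists (mod_Iirr j); rewrite mod_IirrE // cfMod1 -Dj.
  rewrite cfInd1 ?quotientS // iGZP lin_char1 ?mulr1 //.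
  by apply/char_abelianP; rewrite ?irr_char // sub_der1_abelian.
(* The kernels of all irreducible characters intersect trivially, so one of them misses part of
   [Z]. *)
have /existsP[j /irr1_faithful <-] :
    [exists j, ~~ (Z \subset cfker 'chi[G]_j)]; last by exists j.
apply: contraR ntZ => /existsPn kerZ; rewrite -subG1 -(TI_cfker_irr G).
by apply/bigcapsP=> j _; have := kerZ j; rewrite negbK.
Qed.

(** An element g of [L] outside the Frobenius kernel acts on it without fixed points, so every
    element of the kernel is a commutator [x, g]. *)
Lemma Frobenius_kernel_sub_der1 (L : {group coset_of Z}) :
    (P / Z)%g \subset L -> L \subset (G / Z)%g -> ~~ (L \subset (P / Z)%g) ->
  (P / Z)%g \subset L^`(1)%g.
Proof.
move=> sPL sLG /subsetPn[g Lg nPg].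
have [_ _ nsPZ regP] := Frobenius_kerP Frobenius_quotient_kernel.
have nPZg : g \in 'N(P / Z) := subsetP (normal_norm nsPZ) g (subsetP sLG g Lg).
rewrite -(comm_set_fixed_point_free nPZg).
  by apply/subsetP=> _ /imsetP[x Px ->]; rewrite mem_commg // (subsetP sPL).
apply/trivgP/subsetP=> x /setIP[Px cgx]; rewrite inE; apply: contraR nPg => ntx.
have Px1 : x \in (P / Z)^#%g by apply/setD1P.
apply: (subsetP (regP x Px1)); apply/setIP; split; first exact: subsetP sLG g Lg.
by rewrite cent1C.
Qed.

(** The derived series descends through [M], [P] and the abelian group [Z], which gives at most 4.
    For the lower bound, [Frobenius_kernel_sub_der1] is applied twice in G/Z, so that P lies in Z
    G^(2). *)
Lemma derived_length_FrobeniusOverHeisenberg : derived_length_is G 4.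
Proof.
have der1G : G^`(1)%g \subset M.
  rewrite der1_min ?normal_norm // cyclic_abelian // prime_cyclic //.
  by rewrite card_quotient ?normal_norm.
have der2G : G^`(2)%g \subset P.
  rewrite (subset_trans (dergS 1 der1G)) // der1_min ?normal_norm //.
have der3G : G^`(3)%g \subset Z.
  exact: subset_trans (dergS 1 der2G) der1P.
have nZG := normal_norm nsZG.
have nsGP : ~~ (G^`(1)%g \subset P).
  by apply: contra nnilGP => sGP; rewrite abelian_nil // sub_der1_abelian.
have sPder1 : (P / Z)%g \subset (G / Z)^`(1)%g.
  apply: Frobenius_kernel_sub_der1; [exact: quotientS | exact: subxx |].
  rewrite quotientSGK //.
  by apply: contra nsGP; apply/subset_trans/der_sub.
have nsder1P : ~~ ((G / Z)^`(1)%g \subset (P / Z)%g).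
  by rewrite -quotient_der // quotientSGK // (subset_trans (der_sub 1 G)).
have der2GZ : (P / Z)%g \subset (G^`(2) / Z)%g.
  rewrite quotient_der //.
  exact: Frobenius_kernel_sub_der1 sPder1 (der_sub 1 _) nsder1P.
(* If G^(2) were abelian, so would be Z G^(2), since [Z] centralises [P]; then [P] would be abelian,
   and [comm_P] would make [Z] trivial. *)
have ntder3 : G^`(3)%g != 1%g.
  apply: contra ntZ => /eqP/commG1P abG2.
  have cPZ : P \subset 'C(Z) := subset_trans sPM cZM.
  have abP : abelian P.
    have sPG2Z : P \subset (Z * G^`(2))%g.
      rewrite -quotientSK ?(subset_trans sPG) //.
    apply: abelianS sPG2Z _.
    rewrite abelianM; apply/and3P; split=> //.
      exact: subset_trans sZP cPZ.
    exact: subset_trans der2G cPZ.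
  have [x Px nZx] : exists2 x, x \in P & x \notin Z.
    by apply/subsetPn; apply: contra prPZ => sPZ; rewrite eqEsubset sPZ.
  rewrite -subG1; apply/subsetP=> z Zz.
  have [|y Py ->] := comm_P _ Zz (x := x); first by rewrite inE nZx.
  by rewrite inE; apply/commgP; apply: (centsP abP).
have abZ : abelian Z by apply: subset_trans (subset_trans sZP sPM) cZM.
split; first by apply/eqP/commG1P; apply: abelianS der3G abZ.
move=> m; rewrite ltnS => le_m3; apply: contra ntder3 => /eqP Gm1.
rewrite -subG1 -Gm1 -(subnKC le_m3).
by elim: (3 - m)%N => [|k IHk]; rewrite ?addn0 // addnS (subset_trans (der_subS _ _)).
Qed.

(** In the nilpotent group F(G)/Z the normal subgroup P/Z meets the centre nontrivially, and the
    centraliser of a nontrivial element of the Frobenius kernel P/Z lies in P/Z. *)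
Lemma Fitting_FrobeniusOverHeisenberg : 'F(G) = P.
Proof.
apply/eqP; rewrite eqEsubset Fitting_max // andbT.
have nZG := normal_norm nsZG.
have [ntPZ _ nsPZ regP] := Frobenius_kerP Frobenius_quotient_kernel.
have sPF : P \subset 'F(G) by apply: Fitting_max.
rewrite -(quotientSGK (subset_trans (Fitting_sub G) nZG) sZP).
have nsPF : (P / Z)%g <| ('F(G) / Z)%g.
  by apply: normalS nsPZ; rewrite quotientS // Fitting_sub.
have nilF : nilpotent ('F(G) / Z) by rewrite quotient_nil ?Fitting_nil.
have /trivgPn[x /setIP[Px /setIP[_ cFx]] ntx] := meet_center_nil nilF nsPF ntPZ.
apply: subset_trans (regP x _); last by rewrite !inE ntx.
by rewrite subsetI quotientS ?Fitting_sub // sub_cent1.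
Qed.

(** The abelian normal subgroup M/P has prime index, hence is maximal, and the Fitting subgroup
    above it cannot be the non-nilpotent G/P. *)
Lemma Fitting_quotient_FrobeniusOverHeisenberg : 'F(G / P) = (M / P)%g.
Proof.
have sMF : (M / P)%g \subset 'F(G / P).
  by rewrite Fitting_max ?quotient_normal ?abelian_nil.
have iGPM : #|G / P : M / P| = #|G : M|.
  by rewrite index_quotient_eq ?normal_norm // (subset_trans _ sPM) ?subsetIr.
have /maximal_eqP[_ maxM] : maximal_eq (M / P) (G / P).
  by apply/orP; right; rewrite p_index_maximal ?quotientS ?iGPM.
have [|->//|defF] := maxM 'F(G / P)%G sMF; first exact: Fitting_sub.
by case/negP: nnilGP; rewrite -defF Fitting_nil.
Qed.

Lemma Fitting_height_FrobeniusOverHeisenberg : Fitting_height_is G 3.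
Proof.
have F1 : Fitting_series G 1 = P.
  apply: group_inj => /=.
  rewrite -(injm_Fitting (coset1_injm _)) ?norms1 //.
  by rewrite quotientGK ?normal1 //; apply: Fitting_FrobeniusOverHeisenberg.
have FS n : Fitting_series G n.+1
    = (coset (Fitting_series G n) @*^-1 'F(G / Fitting_series G n))%G by [].
have F2 : Fitting_series G 2 = M.
  apply: group_inj; rewrite FS F1 /=.
  by rewrite Fitting_quotient_FrobeniusOverHeisenberg quotientGK.
split.
  apply/eqP; rewrite FS F2 /=.
  have /nilpotent_Fitting-> : nilpotent (G / M).
    rewrite abelian_nil // cyclic_abelian // prime_cyclic //.
    by rewrite card_quotient ?normal_norm.
  by rewrite quotientGK.
have ltMG : ~~ (G \subset M).
  by apply: contraL prGM => sGM; rewrite -indexg_eq1 in sGM; rewrite (eqP sGM).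
case=> [|[|[|//]]] _; rewrite ?F1 ?F2; apply: contra ltMG => /eqP <- //.
exact: sub1G.
Qed.

End FrobeniusOverHeisenberg.

End CharacterDegrees.

(** * Arithmetic of [p ^ q - 1] *)

Section GeometricSum.

Variables p q : nat.
Hypotheses (pr_p : prime p) (pr_q : prime q) (odd_q : odd q).
Hypothesis dv_q : q %| p - 1.

Local Notation S := (\sum_(i < q) p ^ i).

Lemma expn_sub1_geometric : p ^ q - 1 = (p - 1) * S.
Proof. by rewrite !subn1 predn_exp. Qed.

Lemma geometric_sum_mod (m : nat) : m %| p - 1 -> S = q %[mod m].
Proof.
move=> dv_m; have p1 : p = 1 %[mod m].
  by apply/eqP; rewrite eqn_mod_dvd ?prime_gt0.
rewrite -[in RHS](card_ord q) -sum1_card.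
elim/big_ind2: _ => // [a b c d ab cd | i _].
  by rewrite -modnDm ab cd modnDm.
by rewrite -modnXm p1 modnXm exp1n.
Qed.

(** Write p = 1 + kq. Modulo q^2 the power p^i is 1 + ikq, so the sum is q + kq C(q, 2). Since q is
    odd, it divides C(q, 2), and the sum is q modulo q^2. *)
Lemma logn_geometric_sum : logn q S = 1.
Proof.
have q_gt2 : 2 < q by rewrite odd_prime_gt2.
have [k Dp] : exists k, p = k * q + 1.
  by exists ((p - 1) %/ q); rewrite divnK // subnK ?prime_gt0.
have S_gt0 : 0 < S.
  by rewrite -(ltn_predK q_gt2) big_ord_recl addn_gt0.
have expE i : p ^ i = 1 + i * (k * q) %[mod q ^ 2].
  elim: i => // i IHi; rewrite expnS -modnMmr IHi modnMmr Dp.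
  have -> : (k * q + 1) * (1 + i * (k * q)) = i * k ^ 2 * q ^ 2 + (1 + i.+1 * (k * q)).
    by rewrite mulSn; ring.
  by rewrite modnMDl.
have SE : S = q %[mod q ^ 2].
  have -> : S = \sum_(i < q) (1 + i * (k * q)) %[mod q ^ 2].
    elim/big_ind2: _ => // a b c d ab cd.
    by rewrite -modnDm ab cd modnDm.
  rewrite big_split /= -big_distrl /= sum1_card card_ord.
  have -> : \sum_(i < q) i = 'C(q, 2) by rewrite -bin2_sum big_mkord.
  have /dvdnP[c ->] : q %| 'C(q, 2) by rewrite prime_dvd_bin.
  have -> : q + c * q * (k * q) = c * k * q ^ 2 + q by ring.
  by rewrite modnMDl.
have qS : q %| S.
  by rewrite /dvdn geometric_sum_mod // modnn.
apply/eqP; rewrite eqn_leq -[1 <= _]pfactor_dvdn // expn1 qS andbT.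
rewrite leqNgt -pfactor_dvdn // /dvdn SE -/(_ %| _).
by rewrite gtnNdvd ?prime_gt0 // expnS expn1 ltn_Pmull ?prime_gt1 ?prime_gt0.
Qed.

Lemma geometric_sum_part : S`_q = q.
Proof. by rewrite p_part logn_geometric_sum expn1. Qed.

Lemma geometric_sum_gt : q < S.
Proof.
have q_gt2 : 2 < q by rewrite odd_prime_gt2.
have p_gt1 := prime_gt1 pr_p.
have q1_gt0 : 0 < q.-1 by rewrite -ltnS (ltn_predK q_gt2) ltnW.
rewrite -(ltn_predK q_gt2) big_ord_recr /= -addn2 leq_add //.
  rewrite -[leqLHS]card_ord -sum1_card.
  by apply: leq_sum => i _; rewrite expn_gt0 prime_gt0.
by rewrite (leq_trans p_gt1) // -{1}(expn1 p) leq_pexp2l // ltnW.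
Qed.

(** The q-part of p^q - 1 is q times that of p - 1, so the third degree of the theorem is p^q -
    1. *)
Lemma expn_sub1_parts : (p ^ q - 1)`_q^' * (p - 1)`_q * q = p ^ q - 1.
Proof.
have S_gt0 : 0 < S by apply: leq_ltn_trans geometric_sum_gt.
have p1_gt0 : 0 < p - 1 by rewrite subn_gt0 prime_gt1.
rewrite -mulnA mulnC -[RHS](partnC q) ?expn_sub1_geometric ?muln_gt0 ?p1_gt0 //.
by congr (_ * _); rewrite partnM // geometric_sum_part.
Qed.

(** This prime will witness that the nearfield group is not nilpotent. As S > q and q is the q-part
    of S, the q'-part has a prime divisor r; if r divided p - 1, then S = q modulo r would force r =
    q. *)
Lemma prime_dvd_geometric_sum :
  exists r, [/\ prime r, r %| S, r != q & ~~ (r %| p - 1)].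
Proof.
have S_gt0 : 0 < S by apply: leq_ltn_trans geometric_sum_gt.
have S'_gt1 : 1 < S`_q^'.
  rewrite -(ltn_pmul2l (prime_gt0 pr_q)) muln1 -{2}geometric_sum_part.
  by rewrite partnC // geometric_sum_gt.
have pr_r := pdiv_prime S'_gt1; set r := pdiv _ in pr_r.
have rS' : r %| S`_q^' := pdiv_dvd _.
have rS : r %| S := dvdn_trans rS' (dvdn_part _ _).
have rq : r != q.
  have /pnatP := part_pnat q^' S; rewrite part_gt0 => /(_ isT r pr_r rS').
  by [].
exists r; split=> //; apply: contra rq => r1.
have := geometric_sum_mod r1; rewrite (eqP (rS : S %% r == 0)) => /esym/eqP.
by rewrite -/(r %| q) dvdn_prime2.
Qed.

End GeometricSum.

(** * The absolute trace *)

Lemma exists_primitive_root_finField (F : finFieldType) :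
  exists w : F, (#|F|.-1.-primitive_root w)%R.
Proof.
have n_gt0 : 0 < #|F|.-1 by rewrite -subn1 subn_gt0 finNzRing_gt1.
pose rs := [seq x <- enum F | x != 0%R].
have /hasP[w _ prw] : has #|F|.-1.-primitive_root%R rs.
  apply: has_prim_root => //; first 1 last.
  - by rewrite filter_uniq ?enum_uniq.
  - rewrite size_filter -subn1 leq_subLR cardE -(count_predC (pred1 0%R)) leq_add2r.
    by rewrite count_uniq_mem ?enum_uniq // leq_b1.
  apply/allP=> x; rewrite mem_filter => /andP[nz_x _].
  rewrite unity_rootE; apply/eqP/(mulfI nz_x); rewrite mulr1 -exprS.
by rewrite prednK ?expf_card // (ltn_trans _ (finNzRing_gt1 F)).
by exists w.
Qed.

Section AbsoluteTrace.

Local Open Scope ring_scope.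

Variables (p q : nat) (F : finFieldType).
Hypotheses (pcharF : p \in [pchar F]) (cardF : #|F| = (p ^ q)%N).

Let pr_p : prime p := pcharf_prime pcharF.

Lemma expr_pchar_powD i (x y : F) : (x + y) ^+ (p ^ i) = x ^+ (p ^ i) + y ^+ (p ^ i).
Proof. by apply: exprDn_pchar; rewrite pnatX pnatE ?pcharF. Qed.

(** The trace to the prime field, kept with values in [F]: the prime field appears throughout as the
    solutions of x^p = x. *)
Definition absolute_trace (x : F) := \sum_(i < q) x ^+ (p ^ i).
Local Notation Tr := absolute_trace.

Lemma absolute_traceD x y : Tr (x + y) = Tr x + Tr y.
Proof. by rewrite -big_split /=; apply: eq_bigr => i _; rewrite expr_pchar_powD. Qed.

Lemma absolute_trace0 : Tr 0 = 0.
Proof.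
rewrite /Tr big1 // => i _.
by rewrite expr0n expn_eq0 -leqn0 leqNgt prime_gt0.
Qed.

Lemma absolute_traceN x : Tr (- x) = - Tr x.
Proof. by apply: (addrI (Tr x)); rewrite -absolute_traceD !subrr absolute_trace0. Qed.

Lemma absolute_traceZ c x : c ^+ p = c -> Tr (c * x) = c * Tr x.
Proof.
move=> cp; rewrite big_distrr; apply: eq_bigr => i _; rewrite exprMn; congr (_ * _).
by elim: (i : nat) => [|j IHj]; rewrite ?expr1 // expnSr exprM IHj.
Qed.

Lemma absolute_trace_pow1 x : Tr (x ^+ p) = Tr x.
Proof.
rewrite /Tr; case: q cardF => [|n cF]; first by rewrite !big_ord0.
(* Raising to the power p shifts the summands cyclically, because x^(p^q) = x. *)
rewrite big_ord_recr big_ord_recl /= expr1 addrC -exprM -expnS -cF expf_card.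
by congr (_ + _); apply: eq_bigr => i _; rewrite -exprM -expnS.
Qed.

Lemma absolute_trace_pow i x : Tr (x ^+ (p ^ i)) = Tr x.
Proof. by elim: i => [|i IHi]; rewrite ?expr1 // expnSr exprM absolute_trace_pow1. Qed.

Lemma expr_absolute_trace x : Tr x ^+ p = Tr x.
Proof.
rewrite -[RHS]absolute_trace_pow1 /Tr -[p in LHS]expn1.
rewrite (big_morph _ (expr_pchar_powD 1) (_ : 0 ^+ (p ^ 1) = 0)).
  by apply: eq_bigr => i _; rewrite -!exprM expn1 mulnC.
by rewrite expr0n expn1 -leqn0 leqNgt prime_gt0.
Qed.

(** The trace is given by a nonzero polynomial of degree less than p^q, which cannot vanish on all
    of [F]. *)
Lemma absolute_trace_neq0 : exists u, Tr u != 0.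
Proof.
apply/existsP; apply: contraT => /existsPn Tr0.
pose f : {poly F} := \sum_(i < q) 'X^(p ^ i).
have q_gt0 : (0 < q)%N.
  by have := finNzRing_gt1 F; rewrite cardF; case: (q).
have f1 : f`_1 = 1.
  rewrite coef_sum -(prednK q_gt0) big_ord_recl coefXn eqxx big1 ?addr0 // => i _.
  by rewrite coefXn lift0 eq_sym gtn_eqF // -[ltnLHS](expn0 p) ltn_exp2l ?prime_gt1.
have nz_f : f != 0 by apply: contra_eq_neq f1 => ->; rewrite coef0 eq_sym oner_eq0.
have := max_poly_roots nz_f (_ : all (root f) (enum F)) (enum_uniq F).
have -> : all (root f) (enum F).
  apply/allP=> x _; rewrite rootE horner_sum -[X in X == 0]/(\sum_(i < q) _).
  have := Tr0 x; rewrite negbK; congr (_ == _).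
  by apply: eq_bigr => i _; rewrite hornerXn.
move=> /(_ isT); rewrite -cardE cardF ltnNge => /negP[].
apply: leq_trans (size_sum _ _ _) _; apply/bigmax_leqP => i _.
by rewrite size_polyXn ltn_exp2l ?prime_gt1.
Qed.

End AbsoluteTrace.

(** * A Heisenberg group extended by a Dickson nearfield group *)

Section NearfieldHeisenberg.

Local Open Scope group_scope.
Local Open Scope ring_scope.

Variables (p q N : nat) (F : finFieldType) (zeta : F).
Hypotheses (pcharF : p \in [pchar F]) (cardF : #|F| = (p ^ q)%N).
Hypotheses (pr_q : prime q) (prz : q.-primitive_root zeta).
Hypotheses (NqE : (N * q)%N = #|F|.-1) (zetap : zeta ^+ p = zeta).
Hypothesis qN : (q %| N)%N.

Let pr_p : prime p := pcharf_prime pcharF.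
Local Notation Tr := (absolute_trace p q).
Local Notation uval := FinRing.uval.
Local Notation T := (F * F * F)%type.

Implicit Types (c d : {unit F}) (v w : T).

Let q_gt0 : (0 < q)%N := prime_gt0 pr_q.

Fact unit_powN_unity c : (uval c ^+ N) ^+ q = 1.
Proof.
rewrite -exprM NqE; apply: (mulfI (_ : uval c != 0)).
  by rewrite -unitfE (valP c).
by rewrite -exprS prednK ?expf_card ?mulr1 // (ltn_trans _ (finNzRing_gt1 F)).
Qed.

(* The exponent of the Frobenius twist by [c] in the Dickson nearfield [nf_mul]. *)
Definition dlog c : 'I_q := sval (prim_rootP prz (unit_powN_unity c)).

Lemma dlogE c : uval c ^+ N = zeta ^+ dlog c.
Proof. by rewrite /dlog; case: prim_rootP. Qed.

Lemma eq_dlog c i : (uval c ^+ N == zeta ^+ i) = (dlog c == i %[mod q]).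
Proof. by rewrite dlogE (eq_prim_root_expr prz). Qed.

(** * Frobenius powers, Heisenberg translations and twisted semilinear maps of F^3 *)

Definition frob i (x : F) := x ^+ (p ^ i).

Lemma frobD i x y : frob i (x + y) = frob i x + frob i y.
Proof. exact: (expr_pchar_powD pcharF). Qed.

Lemma frobM i x y : frob i (x * y) = frob i x * frob i y.
Proof. by rewrite /frob exprMn. Qed.

Lemma frobX i x n : frob i (x ^+ n) = frob i x ^+ n.
Proof. by rewrite /frob exprAC. Qed.

Lemma frob0 i : frob i 0 = 0.
Proof. by rewrite /frob expr0n expn_eq0 -leqn0 leqNgt prime_gt0. Qed.

Lemma frob_comp i j x : frob i (frob j x) = frob (i + j) x.
Proof. by rewrite /frob -exprM -expnD addnC. Qed.

Lemma frob_mod i x : frob (i %% q) x = frob i x.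
Proof.
rewrite [in RHS](divn_eq i q) addnC -frob_comp; congr (frob _ _).
elim: (i %/ q)%N => [|k IHk]; first by rewrite mul0n /frob expr1.
by rewrite mulSn -frob_comp -IHk /frob -cardF expf_card.
Qed.

Lemma eq_frob i j x : i = j %[mod q] -> frob i x = frob j x.
Proof. by move=> eqij; rewrite -frob_mod eqij frob_mod. Qed.

Lemma frob_inj i : injective (frob i).
Proof.
move=> x y; rewrite /frob => /eqP; rewrite -subr_eq0 => /eqP.
have -> : x ^+ (p ^ i) - y ^+ (p ^ i) = frob i (x - y).
  by apply: (addIr (frob i y)); rewrite -frobD !subrK.
by move/eqP; rewrite expf_eq0 => /andP[_]; rewrite subr_eq0 => /eqP.
Qed.

Lemma frob_zetaX i j : frob i (zeta ^+ j) = zeta ^+ j.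
Proof.
rewrite frobX; congr (_ ^+ _); elim: i => [|i IHi]; first by rewrite /frob expr1.
by rewrite -add1n -frob_comp IHi /frob expn1.
Qed.

(** Right multiplication by [v] in the Heisenberg group on F^3. Both [P] and [H] are realised as
    permutations of F^3, so that [G] is the group they generate. *)
Definition heis_fun v (w : T) : T :=
  (w.1.1 + v.1.1, w.1.2 + v.1.2, w.2 + v.2 + Tr (w.1.1 * v.1.2)).

Definition semi_fun c (w : T) : T :=
  (uval c * frob (dlog c) w.1.1, uval c ^+ N.-1 * frob (dlog c) w.1.2,
   uval c ^+ N * w.2).

Lemma heis_fun_inj v : injective (heis_fun v).
Proof.
by move=> [[x y] z] [[x' y'] z'] [/addIr-> /addIr-> /addIr/addIr->].
Qed.

Let nz c : uval c != 0. Proof. by rewrite -unitfE (valP c). Qed.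

Lemma semi_fun_inj c : injective (semi_fun c).
Proof.
move=> [[x y] z] [[x' y'] z'] [/(mulfI (nz c))/frob_inj->].
by move=> /(mulfI (expf_neq0 _ (nz c)))/frob_inj-> /(mulfI (expf_neq0 _ (nz c)))->.
Qed.

Definition heis v : {perm T} := perm (@heis_fun_inj v).
Definition semi c : {perm T} := perm (@semi_fun_inj c).

Lemma heisM v w : (heis v * heis w)%g = heis (heis_fun w v).
Proof.
apply/permP=> -[[x y] z]; rewrite permM !permE /heis_fun /=.
by rewrite mulrDl mulrDr !(absolute_traceD _ pcharF); congr (_, _, _); ring.
Qed.

Lemma heis0 : heis (0, 0, 0) = 1%g.
Proof.
apply/permP=> -[[x y] z]; rewrite perm1 permE /heis_fun /= mulr0 !addr0.
by rewrite (absolute_trace0 _ pcharF) addr0.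
Qed.

Lemma heis_inj : injective heis.
Proof.
move=> v w /permP/(_ (0, 0, 0)); rewrite !permE /heis_fun /= !add0r !mul0r.
by case: v w => [[x y] z] [[x' y'] z'] /= [-> -> /addIr->].
Qed.

(** The Dickson nearfield product, in the order of composition: [semi c] followed by [semi d] sends
    1 in the first coordinate to it. *)
Definition nf_mul c d : {unit F} := (d * c ^+ (p ^ dlog d))%g.

Lemma val_nf_mul c d : uval (nf_mul c d) = uval d * frob (dlog d) (uval c).
Proof. by rewrite /nf_mul /frob /= FinRing.val_unitX. Qed.

(** N-th powers are powers of [zeta], which the Frobenius maps fix; so c |-> c^N turns the twisted
    product into an ordinary one. *)
Lemma dlog_nf_mul c d : dlog (nf_mul c d) = (dlog d + dlog c)%N %[mod q].
Proof.
apply/eqP; rewrite -eq_dlog val_nf_mul exprMn -frobX !dlogE frob_zetaX.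
by rewrite exprD.
Qed.

Lemma N_gt0 : (0 < N)%N.
Proof.
rewrite lt0n; apply/eqP => N0; have := finNzRing_gt1 F.
by rewrite -subn_gt0 subn1 -NqE N0.
Qed.

Lemma semiM c d : (semi c * semi d)%g = semi (nf_mul c d).
Proof.
have := val_nf_mul c d; have := fun x => eq_frob x (dlog_nf_mul c d).
move: (nf_mul c d) => e frobE valE.
apply/permP=> -[[x y] z]; rewrite permM !permE /semi_fun /=.
rewrite !frobE -!frob_comp valE !exprMn -!frobX !frobM !mulrA.
by congr (_, _, _ * _); rewrite (dlogE c) frob_zetaX.
Qed.

Lemma semi_inj : injective semi.
Proof.
move=> c d /permP/(_ (1, 0, 0)); rewrite !permE /semi_fun /= => -[+ _ _].
by rewrite /frob !expr1n !mulr1 => /val_inj.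
Qed.

Lemma powN_pow_p c : (uval c ^+ N) ^+ p = uval c ^+ N.
Proof. by rewrite dlogE exprAC zetap. Qed.

(** The exponents 1 and N - 1 are chosen to add up to N: in the cocycle the factor c^N lies in the
    prime field and leaves the trace, which itself is invariant under Frobenius. *)
Lemma heisJ v c : (heis v ^ semi c)%g = heis (semi_fun c v).
Proof.
rewrite conjgE; apply: (canLR (mulKg _)); apply/permP=> -[[x y] z].
rewrite !permM !permE /heis_fun /semi_fun /= !frobD; congr (_, _, _).
- by rewrite mulrDr.
- by rewrite mulrDr.
rewrite mulrACA -exprS (prednK N_gt0) -frobM (absolute_traceZ _ _ (powN_pow_p c)).
by rewrite /frob (absolute_trace_pow cardF) !mulrDr.
Qed.

(** * The groups P, Z and H, with third coordinates in the prime field, and their product G *)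

Lemma fix_frobD (x y : F) : x ^+ p = x -> y ^+ p = y -> (x + y) ^+ p = x + y.
Proof. by move=> xp yp; rewrite -{1}[p]expn1 (expr_pchar_powD pcharF) expn1 xp yp. Qed.

Lemma fix_frobM (x y : F) : x ^+ p = x -> y ^+ p = y -> (x * y) ^+ p = x * y.
Proof. by move=> xp yp; rewrite exprMn xp yp. Qed.

Lemma fix_frobN (x : F) : x ^+ p = x -> (- x) ^+ p = - x.
Proof.
move=> xp; apply: (addrI x); rewrite -{1}xp -[p in LHS]expn1.
by rewrite -(expr_pchar_powD pcharF) subrr -/(frob 1 0) frob0.
Qed.

Definition heis_set := heis @: [set v : T | v.2 ^+ p == v.2].
Definition heis_center_set :=
  heis @: [set v : T | [&& v.1.1 == 0, v.1.2 == 0 & v.2 ^+ p == v.2]].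
Definition semi_set := semi @: [set: {unit F}].

Lemma mem_heis v : (heis v \in heis_set) = (v.2 ^+ p == v.2).
Proof. by rewrite (mem_imset _ _ heis_inj) inE. Qed.

Lemma mem_heis_center v :
  (heis v \in heis_center_set) = [&& v.1.1 == 0, v.1.2 == 0 & v.2 ^+ p == v.2].
Proof. by rewrite (mem_imset _ _ heis_inj) inE. Qed.

Lemma mem_semi c : semi c \in semi_set.
Proof. exact: imset_f. Qed.

Lemma heisP g : reflect (exists2 v, v.2 ^+ p = v.2 & g = heis v) (g \in heis_set).
Proof.
apply: (iffP imsetP) => [[v] | [v vp ->]]; first by rewrite inE => /eqP; exists v.
by exists v; rewrite ?inE ?vp.
Qed.

Lemma heis_centerP g :
  reflect (exists2 e, e ^+ p = e & g = heis (0, 0, e)) (g \in heis_center_set).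
Proof.
apply: (iffP imsetP) => [[[[x y] z]] | [e ep ->]].
  by rewrite inE /= => /and3P[/eqP-> /eqP-> /eqP]; exists z.
by exists (0, 0, e); rewrite ?inE //= ep !eqxx.
Qed.

Lemma heis_group_set : group_set heis_set.
Proof.
apply/group_setP; split.
  by rewrite -heis0 mem_heis /= expr0n -leqn0 leqNgt prime_gt0.
move=> _ _ /heisP[v vp ->] /heisP[w wp ->]; rewrite heisM mem_heis /=.
by apply/eqP; rewrite !fix_frobD ?(expr_absolute_trace pcharF cardF).
Qed.

Lemma heis_center_group_set : group_set heis_center_set.
Proof.
apply/group_setP; split.
  by rewrite -heis0 mem_heis_center /= !eqxx expr0n -leqn0 leqNgt prime_gt0 /=.
move=> _ _ /heis_centerP[e ep ->] /heis_centerP[f fp ->]; rewrite heisM mem_heis_center /=.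
rewrite !addr0 !eqxx /=; apply/eqP.
by rewrite !fix_frobD ?(expr_absolute_trace pcharF cardF).
Qed.

Lemma frob_dlog_id c x : uval c ^+ N = 1 -> frob (dlog c) x = x.
Proof.
move=> cN; have dc : dlog c = 0 %[mod q] by apply/eqP; rewrite -eq_dlog cN expr0.
by rewrite (eq_frob _ dc) /frob !expr1.
Qed.

Lemma semi1 : semi 1%g = 1%g.
Proof.
have [c -> Dc] : exists2 c : {unit F}, 1%g = c & uval c = 1 by exists 1%g.
apply/permP=> -[[x y] z]; rewrite perm1 permE /semi_fun /=.
by rewrite !frob_dlog_id ?Dc ?expr1n ?mul1r.
Qed.

Lemma semi_group_set : group_set semi_set.
Proof.
apply/group_setP; split; first by rewrite -semi1 mem_semi.
by move=> _ _ /imsetP[c _ ->] /imsetP[d _ ->]; rewrite semiM mem_semi.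
Qed.

Definition heis_group := Group heis_group_set.
Definition heis_center_group := Group heis_center_group_set.
Definition semi_group := Group semi_group_set.

Local Notation P := heis_group.
Local Notation Z := heis_center_group.
Local Notation H := semi_group.

Lemma semi_norm_heis : H \subset 'N(P).
Proof.
apply/subsetP=> _ /imsetP[c _ ->]; rewrite inE.
apply/subsetP=> _ /imsetP[_ /heisP[v vp ->] ->].
by rewrite heisJ mem_heis /=; apply/eqP; rewrite fix_frobM ?powN_pow_p.
Qed.

Lemma heis_semi_TI : P :&: H = 1%g.
Proof.
apply/trivgP/subsetP=> _ /setIP[/heisP[[[a b] e] _ ->] /imsetP[c _ eqvc]].
(* The semilinear maps fix the origin, while the translation by v moves it to v. *)
have /permP/(_ (0, 0, 0)) := eqvc; rewrite !permE /heis_fun /semi_fun /=.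
rewrite !frob0 !mulr0 !add0r !mul0r => -[-> -> /eqP].
by rewrite (absolute_trace0 _ pcharF) addr0 => /eqP->; rewrite heis0.
Qed.

Definition nearfield_heis_group := (P <*> H)%G.
Local Notation G := nearfield_heis_group.

Lemma nearfield_heis_groupE : G = (P * H)%g :> {set {perm T}}.
Proof. exact: norm_joinEr semi_norm_heis. Qed.

Lemma nearfield_heis_sdprod : (P ><| H)%g = G.
Proof. by rewrite sdprodEY ?semi_norm_heis ?heis_semi_TI. Qed.

Lemma nearfield_heisP g :
  reflect (exists v c, v.2 ^+ p = v.2 /\ g = (heis v * semi c)%g) (g \in G).
Proof.
rewrite nearfield_heis_groupE; apply: (iffP mulsgP).
  move=> [_ _ /heisP[v vp ->] /imsetP[c _ ->] ->].
  by exists v, c.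
move=> [v [c [vp ->]]]; exists (heis v) (semi c); rewrite ?mem_semi //.
by apply/heisP; exists v.
Qed.

Lemma card_semi : #|H| = #|F|.-1.
Proof. by rewrite card_imset ?card_finField_unit //; apply: semi_inj. Qed.

Lemma card_heis : #|P| = (#|F| ^ 2 * #|Z|)%N.
Proof.
rewrite !card_imset; try exact: heis_inj.
pose E := [set e : F | e ^+ p == e].
have -> : [set v : T | v.2 ^+ p == v.2] = setX [set: F * F] E.
  by apply/setP=> -[u e]; rewrite !inE.
have -> : [set v : T | [&& v.1.1 == 0, v.1.2 == 0 & v.2 ^+ p == v.2]]
    = setX [set (0, 0)] E.
  by apply/setP=> -[[x y] e]; rewrite !inE xpair_eqE andbA.
by rewrite !cardsX cards1 mul1n cardsT card_prod expnS expn1.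
Qed.

(** The solutions of e^p = e form an additive subgroup of [F], so their number divides p^q. *)
Lemma heis_center_pgroup : p.-group Z.
Proof.
rewrite /pgroup card_imset; last exact: heis_inj.
pose E := [set e : F | e ^+ p == e].
have -> : [set v : T | [&& v.1.1 == 0, v.1.2 == 0 & v.2 ^+ p == v.2]]
    = setX [set (0, 0)] E.
  by apply/setP=> -[[x y] e]; rewrite !inE xpair_eqE andbA.
have gE : group_set E.
  apply/group_setP; split=> [|x y]; rewrite !inE.
    by rewrite FinRing.zmod1gE expr0n -leqn0 leqNgt prime_gt0.
  by move=> /eqP xp /eqP yp; rewrite FinRing.zmodMgE fix_frobD.
rewrite cardsX cards1 mul1n -[E]/(gval (Group gE)).
apply: pnat_dvd (cardSg (subsetT _)) _.
by rewrite cardsT cardF pnatX pnat_id.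
Qed.

Lemma heis_pgroup : p.-group P.
Proof.
rewrite /pgroup card_heis pnatM cardF -expnM pnatX pnat_id //.
exact: heis_center_pgroup.
Qed.

Lemma commg_heis v w :
  [~ heis v, heis w] = heis (0, 0, Tr (v.1.1 * w.1.2) - Tr (w.1.1 * v.1.2)).
Proof.
apply: (mulgI (heis w * heis v)%g); rewrite -commgC !heisM /heis_fun /=.
rewrite mulr0 (absolute_trace0 _ pcharF).
by congr (heis (_, _, _)); ring.
Qed.

Lemma heis_centerJ e v c :
  (heis (0, 0, e) ^ (heis v * semi c))%g = heis (0, 0, uval c ^+ N * e).
Proof.
have /conjg_fixP fixv : [~ heis (0, 0, e), heis v] == 1%g.
  by rewrite commg_heis /= mul0r mulr0 subrr heis0.
by rewrite conjgM fixv heisJ /semi_fun /= frob0 !mulr0.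
Qed.

Lemma center_sub_heis : Z \subset P.
Proof.
apply/subsetP=> _ /heis_centerP[e ep ->]; rewrite mem_heis /=; exact/eqP.
Qed.

Lemma heis_normal : P <| G.
Proof. by have [] := sdprod_context nearfield_heis_sdprod. Qed.

Lemma heis_center_normal : Z <| G.
Proof.
rewrite /normal (subset_trans center_sub_heis (normal_sub heis_normal)) /=.
apply/subsetP=> _ /nearfield_heisP[v [c [vp ->]]]; rewrite inE.
apply/subsetP=> _ /imsetP[_ /heis_centerP[e ep ->] ->].
by rewrite heis_centerJ mem_heis_center /= !eqxx fix_frobM ?powN_pow_p /=.
Qed.

(** * The centraliser M of Z, commutators, regularity and indices *)

Definition center_centralizer := 'C_G(Z)%G.
Local Notation M := center_centralizer.

Lemma center_centralizer_normal : M <| G.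
Proof.
rewrite /normal subsetIl normsI ?normG //.
by rewrite (subset_trans (normal_norm heis_center_normal)) // cent_norm.
Qed.

Let one_p : (1 : F) ^+ p = 1. Proof. exact: expr1n. Qed.

Lemma mem_center_centralizer v c : v.2 ^+ p = v.2 ->
  ((heis v * semi c)%g \in M) = (uval c ^+ N == 1).
Proof.
move=> vp; have Gvc : (heis v * semi c)%g \in G by apply/nearfield_heisP; exists v, c.
rewrite inE Gvc /=; apply/centP/eqP => [cZ | cN _ /heis_centerP[e ep ->]].
  have Z1 : heis (0, 0, 1) \in Z by rewrite mem_heis_center /= !eqxx one_p eqxx.
  have /conjg_fixP := introT commgP (commute_sym (cZ _ Z1)).
  by rewrite heis_centerJ mulr1 => /heis_inj[].
apply/commute_sym/commgP/conjg_fixP.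
by rewrite heis_centerJ cN mul1r.
Qed.

Lemma heis_sub_center_centralizer : P \subset M.
Proof.
apply/subsetP=> _ /heisP[v vp ->].
rewrite inE (subsetP (normal_sub heis_normal)) ?mem_heis ?vp //=.
apply/centP=> _ /heis_centerP[e ep ->]; apply/commgP.
by rewrite commg_heis /= mulr0 mul0r subrr heis0.
Qed.

Lemma heis_center_neq1 : Z :!=: 1%g.
Proof.
apply/trivgPn; exists (heis (0, 0, 1)).
  by rewrite mem_heis_center /= !eqxx one_p eqxx.
by rewrite -heis0 (inj_eq heis_inj) xpair_eqE eqxx oner_eq0.
Qed.

Lemma heis_neq_center : P :!=: Z.
Proof.
apply/eqP=> eqPZ; have : heis (1, 0, 1) \in P by rewrite mem_heis /= one_p eqxx.
by rewrite eqPZ mem_heis_center /= oner_eq0.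
Qed.

Lemma der1_heis_sub_center : P^`(1)%g \subset Z.
Proof.
rewrite gen_subG; apply/subsetP=> _ /imset2P[_ _ /heisP[v vp ->] /heisP[w wp ->] ->].
rewrite commg_heis mem_heis_center /= !eqxx /=; apply/eqP.
by rewrite fix_frobD ?fix_frobN ?(expr_absolute_trace pcharF cardF).
Qed.

(** This is nondegeneracy of the alternating form Tr(x y') - Tr(x' y). With Tr u nonzero, (e / Tr u)
    u has trace e for e in the prime field; dividing by a nonzero coordinate of v gives the other
    argument. *)
Lemma center_commutators_heis :
  {in P :\: Z & Z, forall x z, exists2 y, y \in P & z = [~ x, y]}.
Proof.
have [u nzTu] := absolute_trace_neq0 pcharF cardF.
have TrE e : e ^+ p = e -> Tr (e / Tr u * u) = e.
  move=> ep; rewrite absolute_traceZ ?divfK // expr_div_n ep.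
  by rewrite (expr_absolute_trace pcharF cardF).
have zero_p : (0 : F) ^+ p = 0 by rewrite expr0n -leqn0 leqNgt prime_gt0.
move=> _ _ /setDP[/heisP[v vp ->] nZv] /heis_centerP[e ep ->].
have [v1z | nzv1] := eqVneq v.1.1 0; last first.
  exists (heis (0, v.1.1^-1 * (e / Tr u * u), 0)).
    by rewrite mem_heis /= zero_p.
  by rewrite commg_heis /= mulVKf // mul0r (absolute_trace0 _ pcharF) subr0 TrE.
have nzv2 : v.1.2 != 0.
  by apply: contra nZv => v2z; rewrite mem_heis_center v1z eqxx v2z vp eqxx.
exists (heis (- (e / Tr u * u / v.1.2), 0, 0)); first by rewrite mem_heis /= zero_p.
rewrite commg_heis /= mulr0 (absolute_trace0 _ pcharF) sub0r mulNr divfK //.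
by rewrite (absolute_traceN _ pcharF) opprK TrE.
Qed.

(** Outside [M] the action on [Z] is multiplication by some c^N other than 1, and c^N - 1 is
    invertible in the prime field. *)
Lemma center_commutators_nearfield :
  {in G :\: M & Z, forall g z, exists2 y, y \in Z & z = [~ y, g]}.
Proof.
move=> _ _ /setDP[/nearfield_heisP[v [c [vp ->]]] nMg] /heis_centerP[e ep ->].
have nzc : uval c ^+ N - 1 != 0.
  by rewrite subr_eq0 -(mem_center_centralizer c vp).
have cp : (uval c ^+ N - 1) ^+ p = uval c ^+ N - 1.
  by rewrite fix_frobD ?fix_frobN ?powN_pow_p.
pose f := e / (uval c ^+ N - 1).
have fp : f ^+ p = f by rewrite expr_div_n ep cp.
exists (heis (0, 0, f)); first by rewrite mem_heis_center /= !eqxx fp /=.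
apply: (mulgI (heis (0, 0, f))); rewrite -conjg_mulR heis_centerJ heisM /heis_fun /=.
rewrite !addr0 mul0r (absolute_trace0 _ pcharF) addr0; congr (heis (_, _, _)).
by rewrite /f; field.
Qed.

(* [a ^+ N] is a power of [zeta], hence fixed by [frob i], and cancels. *)
Lemma powN_eq1 (b a : F) i :
  b * frob i a = a -> a != 0 -> b ^+ N = 1.
Proof.
move=> ba nza; have /(congr1 (fun x => x ^+ N)) := ba.
rewrite exprMn -frobX.
have /(prim_rootP prz)[j ->] : (a ^+ N) ^+ q = 1.
  have ua : a \is a GRing.unit by rewrite unitfE.
  exact: (unit_powN_unity (FinRing.Unit ua)).
rewrite frob_zetaX -[RHS]mul1r => /mulIf; apply.
by rewrite expf_neq0 // (prim_root_eq0 prz) -lt0n.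
Qed.

Lemma dvdn_dlog c : (q %| dlog c)%N -> uval c ^+ N = 1.
Proof. by rewrite dlogE => /dvdnP[k ->]; rewrite mulnC exprM (prim_expr_order prz) expr1n. Qed.

(** A nonzero fixed coordinate forces c^N = 1, which removes the twist and leaves c = 1 or c^(N-1) =
    1. For the second coordinate, [powN_eq1] only gives (c^N)^(N-1) = 1; as q divides N, N - 1 is
    coprime to q, the order of [zeta], and c^N = 1 follows. *)
Lemma semi_fun_fix v c : c != 1%g ->
    uval c * frob (dlog c) v.1.1 = v.1.1 ->
    uval c ^+ N.-1 * frob (dlog c) v.1.2 = v.1.2 ->
  v.1.1 = 0 /\ v.1.2 = 0.
Proof.
move=> ntc fix1 fix2; split; apply: contraNeq ntc => nzv; apply/eqP/val_inj => /=.
  have cN := powN_eq1 fix1 nzv; move: fix1; rewrite frob_dlog_id //.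
  by rewrite -[RHS]mul1r => /(mulIf nzv).
have cN : uval c ^+ N = 1.
  apply: dvdn_dlog; have := powN_eq1 fix2 nzv.
  rewrite exprAC dlogE -exprM => /eqP; rewrite -(prim_order_dvd prz).
  rewrite Gauss_dvdl // (coprime_dvdl qN) // -{1}(prednK N_gt0).
  by rewrite coprimeSn.
move: fix2; rewrite frob_dlog_id // -[RHS]mul1r => /(mulIf nzv) cN1.
by move: cN; rewrite -(prednK N_gt0) exprS cN1 mulr1.
Qed.

Lemma heis_regular :
  {in P & G :\: P, forall x g, [~ x, g] \in Z -> x \in Z}.
Proof.
move=> _ _ /heisP[v vp ->] /setDP[/nearfield_heisP[w [c [wp ->]]] nPg] /heis_centerP[e ep].
have ntc : c != 1%g.
  apply: contra nPg => /eqP->; rewrite semi1 mulg1 mem_heis; exact/eqP.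
move/(congr1 (mulg (heis v))).
(* Conjugation by [heis w] changes only the third coordinate of v, so modulo [Z] only [semi c]
   acts. *)
rewrite -conjg_mulR conjgM [(heis v ^ heis w)%g]conjg_mulR commg_heis.
rewrite !heisM heisJ => /heis_inj[]; rewrite !addr0 => fix1 fix2 _.
have [v1 v2] := semi_fun_fix ntc fix1 fix2.
by rewrite mem_heis_center v1 v2 vp !eqxx.
Qed.

(** Where c^N = 1 the twist is trivial and the nearfield product is the commutative field
    product. *)
Lemma abelian_center_centralizer_quotient : abelian (M / P)%g.
Proof.
pose B := semi @: [set c | uval c ^+ N == 1].
have abB : abelian B.
  apply/centsP=> _ /imsetP[c + ->] _ /imsetP[d + ->]; rewrite !inE => /eqP cN /eqP dN.
  rewrite /commute !semiM; congr semi; apply: (val_inj : injective uval).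
  by rewrite !val_nf_mul !frob_dlog_id // mulrC.
have sMPB : M \subset (P * B)%g.
  apply/subsetP=> g Mg; have /nearfield_heisP[v [c [vp Dg]]] := subsetP (subsetIl _ _) g Mg.
  move: Mg; rewrite Dg mem_center_centralizer // => cN.
  by rewrite mem_mulg ?mem_heis ?vp // imset_f ?inE.
apply: abelianS (quotientS P sMPB) _.
by rewrite quotientMidl quotient_abelian.
Qed.

(** [M] is already the centraliser of the single element (0, 0, 1), whose conjugates are the (0, 0,
    zeta^i); powers of w reach all q of them. *)
Lemma index_center_centralizer (w : {unit F}) :
  uval w ^+ N = zeta -> #|G : M| = q.
Proof.
move=> wN; pose z1 := heis (0, 0, 1).
have -> : M = 'C_G[z1] :> {set {perm T}}.
  apply/setP=> g; apply/idP/idP => [Mg | /setIP[Gg /cent1P cg]].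
    apply/setIP; split; first exact: subsetP (subsetIl _ _) g Mg.
    apply/cent1P/(centP (subsetP (subsetIr _ _) g Mg)).
    by rewrite mem_heis_center /= !eqxx one_p eqxx.
  have /nearfield_heisP[v [c [vp Dg]]] := Gg; rewrite Dg mem_center_centralizer //.
  have /conjg_fixP := introT commgP (commute_sym cg).
  by rewrite Dg /z1 heis_centerJ mulr1 => /heis_inj[->].
rewrite index_cent1.
have -> : z1 ^: G = [set heis (0, 0, zeta ^+ i) | i : 'I_q].
  apply/setP=> g; apply/imsetP/imsetP => [[_ /nearfield_heisP[v [c [vp ->]]] ->] | [i _ ->]].
    by exists (dlog c); rewrite // /z1 heis_centerJ mulr1 dlogE.
  have zero_p : (0 : F) ^+ p = 0 by rewrite expr0n -leqn0 leqNgt prime_gt0.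
  exists (heis (0, 0, 0) * semi (w ^+ i)%g)%g.
    by apply/nearfield_heisP; exists (0, 0, 0), (w ^+ i)%g.
  rewrite /z1 heis_centerJ mulr1; congr (heis (_, _, _)).
  by rewrite [uval _]FinRing.val_unitX exprAC wN.
rewrite card_imset ?card_ord // => i j /heis_inj[/eqP].
by rewrite (eq_prim_root_expr prz) !modn_small // => /eqP/val_inj.
Qed.

Lemma index_heis : #|G : P| = #|F|.-1.
Proof.
rewrite -divgS ?(normal_sub heis_normal) // -(sdprod_card nearfield_heis_sdprod).
by rewrite mulKn ?cardG_gt0 ?card_semi.
Qed.

Lemma index_heis_center : #|P : Z| = (#|F| ^ 2)%N.
Proof. by rewrite -divgS ?center_sub_heis // card_heis mulnK ?cardG_gt0. Qed.

Lemma coprime_index_heis : coprime #|M : P| #|P|.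
Proof.
have dv : (#|M : P| %| #|F|.-1)%N.
  have sMG := normal_sub center_centralizer_normal.
  rewrite -index_heis -(Lagrange_index sMG heis_sub_center_centralizer).
  exact: dvdn_mull.
have cop : coprime #|F|.-1 p.
  have : coprime #|F|.-1 #|F|.
    by rewrite -{2}(prednK (ltnW (finNzRing_gt1 F))) coprimenS.
  by rewrite cardF coprime_pexpr.
have [k ->] := p_natP heis_pgroup.
by apply: coprimeXr; apply: coprime_dvdl cop.
Qed.

(** The c with c^r = 1 form a nontrivial normal subgroup K, on which w acts by c |-> c^p. If H were
    nilpotent, K would contain a nontrivial central element; then c^(p-1) = 1 and c^r = 1 with r
    coprime to p - 1, a contradiction. *)
Lemma semi_not_nilpotent (w : {unit F}) (r : nat) :
    dlog w = 1 %[mod q] -> prime r -> (r %| #|F|.-1)%N -> r != q ->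
    ~~ (r %| p - 1)%N ->
  ~~ nilpotent H.
Proof.
move=> dw pr_r rF rq rp; apply/negP=> nilH.
have cop_rq : coprime r q by rewrite prime_coprime // dvdn_prime2.
have rN : (r %| N)%N by rewrite -(Gauss_dvdl _ cop_rq) NqE.
(* As r divides N, elements of K are untwisted, so K multiplies as in the field. *)
have rootN (c : {unit F}) : (c ^+ r)%g = 1%g -> uval c ^+ N = 1.
  move=> /(congr1 uval); rewrite [uval _]FinRing.val_unitX => cr.
  by have /dvdnP[k ->] := rN; rewrite mulnC exprM cr expr1n.
pose K := semi @: [set c | (c ^+ r)%g == 1%g].
have semiJ c d : (c ^+ r)%g = 1%g -> (semi c ^ semi d)%g = semi (c ^+ (p ^ dlog d))%g.
  move=> cr; rewrite conjgE; apply: (canLR (mulKg _)).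
  have cr' : ((c ^+ (p ^ dlog d)) ^+ r)%g = 1%g by rewrite expgAC cr expg1n.
  rewrite !semiM; congr semi; apply: (val_inj : injective uval).
  rewrite !val_nf_mul (frob_dlog_id _ (rootN _ cr')) mulrC; congr (_ * _).
  by rewrite [RHS]FinRing.val_unitX.
have gK : group_set K.
  apply/group_setP; split.
    by rewrite -semi1; apply: imset_f; rewrite inE expg1n.
  move=> _ _ /imsetP[c + ->] /imsetP[d + ->]; rewrite !inE => /eqP cr /eqP dr.
  have -> : (semi c * semi d)%g = semi (c * d)%g.
    rewrite semiM; congr semi; apply: (val_inj : injective uval).
    by rewrite val_nf_mul frob_dlog_id ?rootN // mulrC.
  by apply: imset_f; rewrite inE expgMn ?cr ?dr ?mulg1 //; apply: val_inj; apply: mulrC.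
pose KG := Group gK.
have nsKH : KG <| H.
  apply/andP; split; first by apply/subsetP=> _ /imsetP[c _ ->]; apply: mem_semi.
  apply/subsetP=> _ /imsetP[d _ ->]; rewrite inE.
  apply/subsetP=> _ /imsetP[_ /imsetP[c + ->] ->]; rewrite inE => /eqP cr.
  by rewrite semiJ //; apply: imset_f; rewrite inE expgAC cr expg1n.
have ntK : KG :!=: 1%g.
  have [|c _ oc] := @Cauchy _ r [group of [set: {unit F}]] pr_r.
    by rewrite card_finField_unit.
  apply/trivgPn; exists (semi c).
    by apply: imset_f; rewrite inE -oc expg_order.
  rewrite -semi1 (inj_eq semi_inj); apply: contraTneq pr_r => c1.
  by rewrite -oc c1 order1.
have /trivgPn[_ /setIP[/imsetP[c + ->] /setIP[_ /centP cH]]] :=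
  meet_center_nil nilH nsKH ntK.
rewrite inE -semi1 (inj_eq semi_inj) => /eqP cr /negP[]; rewrite -order_eq1 -dvdn1.
have /conjg_fixP := introT commgP (cH _ (mem_semi w)).
rewrite semiJ // => /semi_inj cw.
have cp : (c ^+ (p - 1))%g = 1%g.
  apply: (mulgI c); rewrite mulg1 -expgS subn1 prednK ?prime_gt0 //.
  apply: (val_inj : injective uval); rewrite [uval _]FinRing.val_unitX.
  rewrite -[RHS](congr1 uval cw) [in RHS]FinRing.val_unitX.
  by rewrite -/(frob _ _) (eq_frob _ dw) /frob expn1.
have /eqP <- : coprime r (p - 1) by rewrite prime_coprime.
by rewrite dvdn_gcd !order_dvdn cr cp !eqxx.
Qed.

End NearfieldHeisenberg.

Theorem theorem3p3 (p q : nat) :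
  prime p -> prime q -> odd q -> (q %| p - 1)%N ->
  exists (gT : finGroupType) (G : {group gT}),
    [/\ solvable G, derived_length_is G 4, Fitting_height_is G 3 &
     forall d : algC, in_cd G d <->
       (d = (1%N%:R)%R \/ d = (q%:R)%R
        \/ d = ((((p ^ q - 1)`_(q^') * (p - 1)`_q * q)%N)%:R)%R
        \/ d = ((p ^ q * q)%N%:R)%R)].
Proof.
move=> pr_p pr_q odd_q dv_q; rewrite expn_sub1_parts //.
have [F pcharF cardF] := pPrimePowerField pr_p (prime_gt0 pr_q).
have F1E : #|F|.-1 = p ^ q - 1 by rewrite cardF subn1.
have F1_gt0 : 0 < #|F|.-1 by rewrite -subn1 subn_gt0 finNzRing_gt1.
(* One factor q comes from p - 1 and one from the geometric sum; this makes q divide N. *)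
have qqF : q * q %| #|F|.-1.
  rewrite F1E expn_sub1_geometric dvdn_mul //.
  by rewrite /dvdn geometric_sum_mod // modnn.
pose N := #|F|.-1 %/ q.
have NqE : N * q = #|F|.-1 by rewrite divnK // (dvdn_trans _ qqF) // dvdn_mull.
have qN : q %| N by rewrite -(dvdn_pmul2r (prime_gt0 pr_q)) NqE.
have [w0 prw] := exists_primitive_root_finField F.
have Uw : w0 \is a GRing.unit.
  by rewrite unitfE (prim_root_eq0 prw) -lt0n.
(* With [zeta] the N-th power of a generator, that generator has twist exponent 1. *)
pose w := FinRing.Unit Uw; pose zeta := (w0 ^+ N)%R.
have N_gt0 : 0 < N by move: F1_gt0; rewrite -NqE muln_gt0 => /andP[].
have prz : (q.-primitive_root zeta)%R.
  have := exp_prim_root prw N.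
  by rewrite -NqE (gcdn_idPl _) ?dvdn_mulr // mulKn.
(* As q divides p - 1, the q-th roots of unity lie in the prime field. *)
have zetap : (zeta ^+ p = zeta)%R.
  rewrite -[in LHS](subnK (prime_gt0 pr_p)) exprD expr1.
  by have /dvdnP[k ->] := dv_q; rewrite mulnC exprM (prim_expr_order prz) expr1n mul1r.
have dw : dlog prz NqE w = 1 %[mod q] by apply/eqP; rewrite -eq_dlog.
have [r [pr_r rS rq rp]] := prime_dvd_geometric_sum pr_p pr_q odd_q dv_q.
have rF : r %| #|F|.-1 by rewrite F1E expn_sub1_geometric dvdn_mull.
pose G := nearfield_heis_group pcharF cardF prz NqE zetap.
pose P := heis_group pcharF cardF.
pose Z := heis_center_group pcharF cardF.
pose M := center_centralizer pcharF cardF prz NqE zetap.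
have nsZG : (Z <| G)%g by apply: (heis_center_normal pcharF cardF prz NqE zetap).
have nsPG : (P <| G)%g by apply: (heis_normal pcharF cardF prz NqE zetap).
have nsMG : (M <| G)%g by apply: (center_centralizer_normal pcharF cardF prz NqE zetap).
have sZP : Z \subset P by apply: (center_sub_heis pcharF cardF).
have sPM : P \subset M by apply: (heis_sub_center_centralizer pcharF cardF prz NqE zetap).
have ntZ : Z :!=: 1%g by apply: (heis_center_neq1 pcharF cardF).
have prPZ : P :!=: Z by apply: (heis_neq_center pcharF cardF).
have der1P : P^`(1)%g \subset Z by apply: (der1_heis_sub_center pcharF cardF).
have commP := @center_commutators_heis p q F pcharF cardF.
have cZM : M \subset 'C(Z)%g by apply: subsetIr.
have commG := @center_commutators_nearfield p q N F zeta pcharF cardF prz NqE zetap.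
have regGP := @heis_regular p q N F zeta pcharF cardF pr_q prz NqE zetap qN.
have iGM : #|G : M|%g = q.
  exact: (@index_center_centralizer _ _ _ _ _ pcharF cardF prz NqE zetap w).
have prGM : prime #|G : M|%g by rewrite iGM.
have abMP : abelian (M / P).
  exact: (abelian_center_centralizer_quotient pcharF cardF prz NqE zetap).
have coMP : coprime #|M : P|%g #|P| by apply: coprime_index_heis.
have nilP : nilpotent P by apply: pgroup_nil (heis_pgroup pcharF cardF).
have nnilGP : ~~ nilpotent (G / P).
  have sdG := nearfield_heis_sdprod pcharF cardF prz NqE zetap.
  rewrite -(isog_nil (sdprod_isog sdG)).
  exact: semi_not_nilpotent dw pr_r rF rq rp.
have iPZ : #|P : Z|%g = (p ^ q) ^ 2 by rewrite -cardF; apply: index_heis_center.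
have dlG : derived_length_is G 4.
  exact: derived_length_FrobeniusOverHeisenberg nsZG nsPG nsMG sZP sPM ntZ prPZ
    der1P commP cZM regGP prGM abMP nnilGP.
have cdG := irr1_FrobeniusOverHeisenberg nsZG nsPG nsMG sZP sPM ntZ prPZ
  der1P commP cZM commG regGP prGM abMP coMP nnilGP iPZ.
have iGP : #|G : P|%g = p ^ q - 1 by rewrite -F1E; apply: index_heis.
exists _, G; split=> //.
- by apply/derivedP; exists 4; apply/eqP; case: dlG.
- exact: Fitting_height_FrobeniusOverHeisenberg nsZG nsPG nsMG sZP sPM prPZ
    regGP prGM abMP nilP nnilGP.
by rewrite iGM iGP mulnC in cdG.
Qed.
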